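(* Let $G$ be a connected finite bipartite graph with at least $4$ vertices. If $G$ has a perfect matching, then the third bi-power $G^3_B$ is Hamiltonian (i.e., has a cycle containing all its vertices).
   Context: For a graph $G$ and integer $t\ge 1$, the $t$-th bi-power $G^t_B$ is the graph on vertex set $V(G)$ in which two vertices $x,y$ are adjacent if and only if the distance $d_G(x,y)$ is odd and at most $t$. In particular $xy\in E(G^3_B)$ iff $d_G(x,y)\in\{1,3\}$. *)

(* Defs.v *)
From mathcomp Require Import all_boot.

Set Implicit Arguments.
Unset Strict Implicit.
Unset Printing Implicit Defensive.

(* A finite simple graph is a symmetric irreflexive adjacency relation
   [e : rel T] on a finite vertex type [T]. *)
Section Graph.

Variables (T : finType) (e : rel T).

Definition connected_graph : Prop := forall x y : T, connect e x y.

Definition bipartite : Prop :=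
  exists A : {set T}, forall x y : T, e x y -> (x \in A) != (y \in A).

Definition edges : {set {set T}} := [set [set p.1; p.2] | p : T * T & e p.1 p.2].

Definition perfect_matching (M : {set {set T}}) : bool :=
  (M \subset edges) && partition M [set: T].

Definition walk (x y : T) (k : nat) : bool :=
  [exists p : k.-tuple T, path e x p && (last x p == y)].

(* [is_dist x y k] means d(x, y) = k.  As a relation it holds for no [k] when
   [x] and [y] lie in different components (infinite distance). *)
Definition is_dist (x y : T) (k : nat) : bool :=
  walk x y k && [forall j : 'I_k, ~~ walk x y j].

Definition bipower (t : nat) : rel T :=
  fun x y => [exists k : 'I_t.+1, odd k && is_dist x y k].

(* [ucycle] also accepts sequences of fewer than three vertices, which are not
   cycles of a simple graph. *)
Definition hamiltonian : Prop :=
  exists c : seq T, [/\ ucycle e c, 2 < size c & forall x : T, x \in c].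

End Graph.

(* Main.v *)
(** Let [m] be the involution exchanging the ends of every matching edge. In a
    bipartite graph a walk of length 3 is an edge of the third bi-power, so it
    suffices to order the vertices cyclically with consecutive ones joined by
    such walks. Contracting the matching edges and rooting a spanning tree at
    [{u, m u}], one builds recursively a path from [u] to [m u] through all
    descendants: the subtree of a child [{c, m c}] is traversed from [m c] to [c].
    The only obstruction is that ends of two sibling blocks may be at distance 5,
    which never happens if the blocks attached to [m u] come before those
    attached to [u]. *)

Require Import Defs.
From mathcomp Require Import all_boot.


Set Implicit Arguments.
Unset Strict Implicit.
Unset Printing Implicit Defensive.

Section Walks.

Variables (T : finType) (e : rel T).

Lemma walkP x y k :
  reflect (exists p, [/\ size p = k, path e x p & last x p = y])
          (walk e x y k).
Proof.
apply: (iffP existsP) => [[p /andP[ep /eqP lp]]|[p [sp ep lp]]].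
  by exists p; rewrite size_tuple.
by exists (Tuple (introT eqP sp)); rewrite /= ep lp eqxx.
Qed.

Lemma walk3P x y :
  reflect (exists a b, [/\ e x a, e a b & e b y]) (walk e x y 3).
Proof.
apply: (iffP (walkP x y 3)) => [[p []]|[a [b [xa ab bY]]]].
  by case: p => [|a [|b [|c []]]] //= _ /and4P[xa ab bc _] <-; exists a, b.
by exists [:: a; b; y]; rewrite /= xa ab bY.
Qed.

Lemma walk3_sym : symmetric e -> symmetric (fun x y => walk e x y 3).
Proof.
move=> e_sym x y; apply/walk3P/walk3P => -[a [b [xa ab bY]]];
  by exists b, a; split; rewrite e_sym.
Qed.

Lemma walk_parity (A : {set T}) x y k :
  (forall a b, e a b -> (a \in A) != (b \in A)) ->
  walk e x y k -> odd k = (x \in A) (+) (y \in A).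
Proof.
move=> eA /walkP[p [<- + <-]] {y k}.
elim: p x => [|z p IHp] x /=; first by rewrite addbb.
move=> /andP[/eA xz /IHp->].
by case: (x \in A) (z \in A) (last z p \in A) xz => [] [] [].
Qed.

(** Every walk between [x] and [y] shares the parity of the given one, so lengths 0 and 2 are
    excluded and the distance is 1 or 3. *)
Lemma bipower_walk3 x y : bipartite e -> walk e x y 3 -> bipower e 3 x y.
Proof.
case=> A eA w3; have par := walk_parity eA.
have odd_walk k : walk e x y k -> odd k.
  by move=> /par->; rewrite -(par _ _ _ w3).
apply/existsP; have [w1|nw1] := boolP (walk e x y 1).
  exists (inord 1); rewrite inordK //= /is_dist w1.
  by apply/forallP=> -[[|//] ?]; apply/negP=> /odd_walk.
exists (inord 3); rewrite inordK //= /is_dist w3.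
by apply/forallP=> -[[|[|[|//]]] ?] //=; apply/negP=> /odd_walk.
Qed.

Lemma perfect_matching_mate (M : {set {set T}}) :
  symmetric e -> irreflexive e -> perfect_matching e M ->
  exists m : T -> T, involutive m /\ forall x, e x (m x).
Proof.
move=> e_sym e_irr /andP[/subsetP Me /and3P[/eqP Mcov Mtriv _]].
have mateP x : exists y, e x y && ([set x; y] \in M).
  have xM : x \in cover M by rewrite Mcov inE.
  have BM := pblock_mem xM; have := xM; rewrite -mem_pblock.
  have /imsetP[[a b]] := Me _ BM; rewrite inE /= => ab E.
  rewrite E in BM *; rewrite !inE => /orP[]/eqP->; first by exists b; rewrite ab.
  by exists a; rewrite e_sym ab setUC.
exists (fun x => xchoose (mateP x)); split=> x; last first.
  by case/andP: (xchooseP (mateP x)).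
set y := xchoose (mateP x); set z := xchoose (mateP y).
have /andP[xy xyM] : e x y && ([set x; y] \in M) := xchooseP (mateP x).
have /andP[_ yzM] : e y z && ([set y; z] \in M) := xchooseP (mateP y).
have yxy : y \in [set x; y] by rewrite !inE eqxx orbT.
have yyz : y \in [set y; z] by rewrite !inE eqxx.
(* Blocks of a partition that share [y] coincide, so taking the mate twice returns to [x]. *)
have E : [set x; y] = [set y; z].
  by rewrite -(def_pblock Mtriv xyM yxy) (def_pblock Mtriv yzM yyz).
have : x \in [set y; z] by rewrite -E !inE eqxx.
by rewrite !inE => /orP[]/eqP xE //; rewrite {1}xE e_irr in xy.
Qed.

Section Mate.

Variable m : T -> T.
Hypotheses (e_sym : symmetric e) (mK : involutive m) (em : forall x, e x (m x)).

Let em' x : e (m x) x. Proof. by rewrite e_sym. Qed.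

(** A block may begin at a neighbour of [u] or at the mate of a neighbour of [m u]. Either way, a
    walk of length 3 leads to it from any neighbour of [m u]. *)
Definition attached u x := e u x || e (m u) (m x).

(* The [attached] conditions are what allows a further block to be inserted at
   either end of [p]. *)
Definition spanning_path u (S : {set T}) := exists p : seq T,
  [/\ uniq p, p =i S, path (fun x y => walk e x y 3) u (rcons p (m u)),
      attached u (head (m u) p) & attached (m u) (last u p)].

(* Cut form of: every vertex of [S] is joined to [u] or [m u] by a path inside
   [S]. *)
Definition reaches u (S : {set T}) := forall X : {set T},
  u \in X -> m u \in X ->
  (forall x y, x \in X -> y \in S -> e x y -> y \in X) -> S \subset X.

Definition mate_closed (S : {set T}) := forall x, (m x \in S) = (x \in S).

(** Reversing the path swaps [u] and [m u], so only children adjacent to [m u] need a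
    construction. *)
Lemma spanning_path_mate u S : spanning_path (m u) S -> spanning_path u S.
Proof.
case=> p [Up pS pathp hd tl]; exists (rev p); split.
- by rewrite rev_uniq.
- by move=> x; rewrite mem_rev.
- move: pathp; rewrite mK -rev_path last_rcons belast_rcons rev_cons.
  by rewrite (eq_path (walk3_sym e_sym)).
- by case/lastP: p tl {Up pS pathp hd} => [|p x]; rewrite ?rev_rcons ?last_rcons mK.
- by case: p hd {Up pS pathp tl} => [|x p]; rewrite ?rev_cons ?last_rcons ?mK.
Qed.

Lemma reaches_mate u S : reaches u S -> reaches (m u) S.
Proof. by move=> uS X uX; rewrite mK => mX; apply: uS. Qed.

(* The block of the child [{c, m c}] goes right after [u]. *)
Lemma spanning_path_insert u c (S C : {set T}) :
  c \in C -> m c \in C -> C \subset S -> e (m u) c -> c != m c ->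
  spanning_path (m c) (C :\ c :\ m c) -> spanning_path u (S :\: C) ->
  spanning_path u S.
Proof.
move=> cC mcC CS uc ncm [q [Uq qC pathq _ _]] [p [Up pS pathp hd tl]].
rewrite mK in pathq.
exists (m c :: rcons q c ++ p); split.
- rewrite /= cat_uniq rcons_uniq mem_cat mem_rcons inE !qC pS !inE !eqxx mcC.
  rewrite /= !andbF !orbF eq_sym ncm Uq Up !andbT /=.
  apply/hasPn=> x; rewrite pS mem_rcons inE qC !inE => /andP[xC _].
  by rewrite (negPf xC) !andbF orbF; apply: contraNneq xC => ->.
- move=> x; rewrite inE mem_cat mem_rcons inE qC pS !inE.
  have [->|] := eqVneq x (m c); first by rewrite (subsetP CS).
  have [->|] /= := eqVneq x c; first by rewrite (subsetP CS).
  by have [/(subsetP CS)->|] := boolP (x \in C).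
- rewrite /= rcons_cat cat_path pathq last_rcons; apply/andP; split.
    by apply/walk3P; exists (m u), c.
  (* The path leaves the block from [c] towards the head of [p], or towards [m u], the default of
     [head], if [p] is empty. *)
  have cx x : attached u x -> walk e c x 3.
    case/orP=> ux; apply/walk3P; first by exists (m u), u; rewrite e_sym.
    by exists (m u), (m x); rewrite e_sym.
  by case: p hd pathp {Up pS tl} => [|x p] /= /cx-> // /andP[].
- by rewrite /attached /= mK uc orbT.
rewrite /= last_cat last_rcons; case: p tl {Up pS pathp hd} => //= _.
by rewrite /attached uc.
Qed.

Lemma reaches_spanning_path u (S : {set T}) :
  irreflexive e -> u \notin S -> mate_closed S -> reaches u S ->
  spanning_path u S.
Proof.
move=> e_irr; have [n] := ubnP #|S|.
elim: n => // n IHn in u S * => leS uS mS reS.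
have [->|[x xS]] := set_0Vmem S.
  (* The defaults of [head] and [last] reduce both [attached] conditions to the matching edge at
     [u]. *)
  exists [::]; split=> //=; rewrite ?/attached ?mK ?em ?em' ?orbT //.
    by move=> x; rewrite inE.
  by rewrite andbT; apply/walk3P; exists (m u), u.
have [v [c [v_u cS vc]]] : exists v c, [/\ v = u \/ v = m u, c \in S & e (m v) c].
  (* Otherwise [[set u; m u]] would be closed in the sense of [reaches] and would contain the
     nonempty [S]. *)
  have: ~~ [forall c in S, ~~ (e u c || e (m u) c)].
    apply/negP=> /forall_inP nS.
    have /subsetP/(_ x xS): S \subset [set u; m u].
      apply: reS; rewrite ?inE ?eqxx ?orbT // => y z.
      move=> /set2P yu /nS; rewrite negb_or => /andP[/negPf uz /negPf muz].
      by case: yu => ->; rewrite ?uz ?muz.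
    by case/set2P=> xE; rewrite xE ?mS (negPf uS) in xS.
  rewrite negb_forall_in => /exists_inP[c cS]; rewrite negbK => /orP[] uc.
    by exists (m u), c; rewrite mK; split=> //; right.
  by exists u, c; split=> //; left.
wlog vu : u uS reS v_u / v = u.
  move=> H; case: (v_u) => vu; first exact: H.
  apply/spanning_path_mate/H; rewrite ?mS ?mK //; first exact: reaches_mate.
  by left.
rewrite vu {v v_u vu} in vc.
pose r := [rel y z | e y z && (z \in S)].
(* The block takes the whole component of [c] in [S], so no edge joins it to the rest of [S]. *)
pose C := [set y | connect r c y].
have cC : c \in C by rewrite inE connect0.
have Cstep y z : y \in C -> z \in S -> e y z -> z \in C.
  rewrite !inE => cy zS yz; apply: connect_trans cy (connect1 _).
  by rewrite /= yz zS.
have Cmin (X : {set T}) : c \in X ->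
    (forall y z, y \in X -> y \in C -> z \in S -> e y z -> z \in X) -> C \subset X.
  move=> cX Xstep; apply/subsetP=> y; rewrite inE => /connectP[p pathp ->].
  have: path r c p := pathp; move: (c) cC cX {pathp}.
  elim: p => //= z p IHp v vC vX /andP[/andP[vz zS]].
  by apply: IHp; [apply: Cstep vz | apply: Xstep vz].
have CS : C \subset S by apply: Cmin.
have mC : mate_closed C.
  have sub y : y \in C -> m y \in C.
    by move=> yC; apply: Cstep (em y); rewrite ?mS ?(subsetP CS).
  by move=> y; apply/idP/idP=> /sub //; rewrite mK.
have ncm : c != m c by apply: contraTneq (em c) => <-; rewrite e_irr.
have ltC : #|S :\: C| < #|S|.
  apply/proper_card/properP; split; first exact: subsetDl.
  by exists c; rewrite // in_setD cC.
apply: (@spanning_path_insert u c S C); rewrite ?mC //.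
- apply: IHn.
  + rewrite -ltnS (leq_trans _ leS) // ltnS; apply: leq_trans (subset_leq_card CS).
    apply: leq_ltn_trans (subset_leq_card (subsetDl _ _)) _.
    by rewrite [ltnRHS](cardsD1 c) cC.
  + by rewrite in_setD1 eqxx.
  + move=> y; rewrite !in_setD1 mC (inj_eq (inv_inj mK)) (can2_eq mK mK).
    by rewrite andbCA.
  + move=> X mcX; rewrite mK => cX Xstep.
    (* Steps landing on [c] or [m c] stay in [X] by assumption, so [X] absorbs all of [C]. *)
    apply: subset_trans (Cmin X cX _).
      exact: subset_trans (subsetDl _ _) (subsetDl _ _).
    move=> y z yX yC zS yz; have zC := Cstep _ _ yC zS yz.
    have [->//|zmc] := eqVneq z (m c); have [->//|zc] := eqVneq z c.
    by apply: Xstep yX _ yz; rewrite !in_setD1 zmc zc.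
- apply: IHn.
  + exact: leq_trans ltC leS.
  + by rewrite in_setD (negPf uS) andbF.
  + by move=> y; rewrite !in_setD mC mS.
  + move=> X uX muX Xstep; rewrite subDset.
    (* The cut is [C :|: X]: an edge from [C] into [S] ends in [C], so the remainder is reached
       through [X] alone. *)
    apply: reS; rewrite ?inE ?uX ?muX ?orbT // => y z yX zS yz; rewrite in_setU.
    have [//|zC] /= := boolP (z \in C).
    case/setUP: yX => [yC|yX]; first by rewrite (Cstep y z) in zC.
    by apply: Xstep yX _ yz; rewrite in_setD zC.
Qed.

End Mate.

End Walks.

Theorem theorem1p3 (T : finType) (e : rel T)
  (e_sym : symmetric e) (e_irr : irreflexive e)
  (e_conn : connected_graph e) (e_bip : bipartite e)
  (card_ge4 : 4 <= #|T|)
  (e_pm : exists M : {set {set T}}, perfect_matching e M) :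
  hamiltonian (bipower e 3).
Proof.
have [M /(perfect_matching_mate e_sym e_irr)[m [mK em]]] := e_pm.
have /card_gt0P[u _] : 0 < #|T| by apply: leq_trans card_ge4.
have num : m u != u by apply: contraTneq (em u) => ->; rewrite e_irr.
have [||| p [Up pS pathp _ _]] :=
    @reaches_spanning_path T e m e_sym mK em u (~: [set u; m u]) e_irr.
- by rewrite !inE eqxx.
- by move=> x; rewrite !inE (inj_eq (inv_inj mK)) (can2_eq mK mK) orbC.
- move=> X uX muX Xstep; apply/subsetP=> x _.
  have Xe v y : v \in X -> e v y -> y \in X.
    move=> vX; have [/set2P[]->//|yS] := boolP (y \in [set u; m u]).
    by apply: Xstep => //; rewrite inE yS.
  have /connectP[p pp ->] := e_conn u x.
  elim: p (u) uX pp => //= y p IHp v vX /andP[/(Xe _ _ vX) yX]; exact: IHp.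
have cov x : x \in u :: rcons p (m u).
  by rewrite inE mem_rcons inE pS !inE; do 2!case: eqP.
have Uc : uniq (u :: rcons p (m u)).
  by rewrite /= rcons_uniq mem_rcons inE !pS !inE !eqxx eq_sym (negPf num) orbT Up.
exists (u :: rcons p (m u)); split=> //.
  rewrite /ucycle Uc andbT /cycle rcons_path last_rcons.
  rewrite (sub_path _ pathp) => [|x y]; last exact: bipower_walk3.
  (* The cycle closes through the walk [m u], [u], [m u], [u]. *)
  by apply: bipower_walk3 => //; apply/walk3P; exists u, (m u); rewrite !(e_sym (m u)).
rewrite -(card_uniqP Uc) (eq_card (B := T)) => [|x]; last exact: cov.
exact: leq_trans card_ge4.
Qed.
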